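(* Let $T$ be a finite rooted tree with root $v$, and suppose $v$ has $m$ subtrees (the subtrees rooted at the children of $v$), with roots $v_1, v_2, \ldots, v_m$ (so $v_1,\ldots,v_m$ are the children of $v$ in $T$). Then the period of $T$ satisfies $$P(T) = (m+2)\,R_T(v) - \sum_{i=1}^{m} R_T(v_i),$$ where $R_T$ is the restoration function of $T$ (an empty sum being $0$).
   Context: All trees are finite. For a vertex $r$ and rooted trees $T_1,\ldots,T_m$ on disjoint vertex sets not containing $r$, $\mathrm{RootedTree}(r,T_1,\ldots,T_m)$ denotes the rooted tree with root $r$ whose subtrees at the children of $r$ are $T_1,\ldots,T_m$ (i.e. $r$ is joined by an edge to the root of each $T_i$). Stochastic abacus on a rooted tree $T$ with root $r$ and vertex set $V_T$. Form the augmented directed graph: replace every edge of $T$ by two directed edges (one in each direction), and for each $v\in V_T$ add a new absorbing vertex $v^*$ together with a directed edge $v\to v^*$. Thus the outdegree of $v\in V_T$ is $\deg_T(v)+1$, and absorbing vertices have no outgoing edges. A state assigns a nonnegative integer number of chips to each vertex. A vertex $v\in V_T$ holding at least $\deg_T(v)+1$ chips may fire: it loses $\deg_T(v)+1$ chips and sends one chip along each of its outgoing edges. Absorbing vertices never fire and only accumulate chips. The critical loading is the state in which each $v\in V_T$ holds exactly $\deg_T(v)$ chips (one less than its outdegree). The abacus starts from the critical loading with all absorbing vertices empty; chips are added one at a time to the root $r$, and after each addition vertices of $V_T$ are fired, in any order, until none can fire. The process stops the first time, after at least one chip has been added, that no vertex can fire and every $v \in V_T$ again holds exactly $\deg_T(v)$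 chips (return to critical loading). The restoration number $R(T)$ is the number of times the root fires during this process; equivalently, the number of chips in the root's absorbing vertex upon return to critical loading. The restoration function $R_T$ is the function on $V_T$ for which $R_T(v)$ is the number of chips in $v$'s absorbing vertex $v^*$ upon return to critical loading (so $R_T(r)=R(T)$). The period $P(T)$ of a rooted tree $T$ is the restoration number of the rooted tree having $T$ as its only subtree: $P(T)=R(\mathrm{RootedTree}(w,T))=R_{\mathrm{RootedTree}(w,T)}(w)$, where $w$ is a new vertex. *)

(* Defs.v *)
From mathcomp Require Import all_boot all_order all_algebra.
From mathcomp Require Import boolp.

Set Implicit Arguments.
Unset Strict Implicit.
Unset Printing Implicit Defensive.

(* Each edge {x, y} already gives the e-cycle x, y of size 2; the graph is
   acyclic when no duplicate-free e-cycle is longer. *)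
Definition is_tree (T : finType) (e : rel T) : Prop :=
  [/\ symmetric e, irreflexive e,
      forall x y, connect e x y &
      forall p : seq T, cycle e p -> uniq p -> size p <= 2].

(* The tree RootedTree(w, T): the new vertex w is None, joined only to the
   root r of T. *)
Definition plant (T : finType) (e : rel T) (r : T) : rel (option T) :=
  fun x y => match x, y with
             | Some u, Some v => e u v
             | None, Some v => v == r
             | Some u, None => u == r
             | None, None => false
             end.

Lemma plant_tree (T : finType) (e : rel T) (r : T) :
  is_tree e -> is_tree (plant e r).
Proof.
case=> sym irr conn acyc.
have psym : symmetric (plant e r) by case=> [x|] [y|] //=.
have cSome x y : connect (plant e r) (Some x) (Some y).
  have /connectP[p pth ->] := conn x y; apply/connectP.
  by exists (map Some p); rewrite ?last_map // path_map.
have cNone x : connect (plant e r) None (Some x).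
  by apply: connect_trans (cSome r x); apply: connect1 => /=.
split=> //.
- by case=> [x|] //=.
- case=> [x|] [y|] //; rewrite ?connect0 //.
  by rewrite (sym_connect_sym psym).
move=> p cyc un; have [pN|pN] := boolP (None \in p).
  have [i q Ep] := rot_to pN.
  have : cycle (plant e r) (None :: q) by rewrite -Ep rot_cycle.
  have : uniq (None :: q) by rewrite -Ep rot_uniq.
  rewrite -(size_rot i p) Ep /=; case: q {Ep} => //= x q /and3P[_ xq _] /andP[rx].
  rewrite rcons_path => /andP[_ rl].
  case: q xq rl => // y q xq; case El: (last x _) => [l|] //= /eqP lr.
  case: x rx xq El => //= x /eqP-> xq El; case/negP: xq.
  by rewrite -lr -El mem_last.
have Ep : p = map Some (pmap id p).
  elim: p pN {cyc un} => //= -[x|] p IH; rewrite inE //= => /IH {1}->//.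
rewrite Ep size_map; apply: acyc.
  by move: cyc; rewrite {1}Ep; case: (pmap id p) => //= a l;
     rewrite -map_rcons path_map.
by move: un; rewrite {1}Ep map_inj_uniq // => x y [].
Qed.

Definition deg (T : finType) (e : rel T) (v : T) : nat := #|[set u | e v u]|.

(* In the augmented directed graph, inl v is the vertex v of the tree and
   inr v is its absorbing vertex v*. *)
Definition arc (T : finType) (e : rel T) : rel (T + T) :=
  fun x y => match x, y with
             | inl u, inl v => e u v
             | inl u, inr v => u == v
             | inr _, _ => false
             end.

Definition state (T : finType) : Type := {ffun T + T -> nat}.

Definition critical_loading (T : finType) (e : rel T) : state T :=
  [ffun x => if x is inl v then deg e v else 0].

(* The absorbing vertices are unconstrained. *)
Definition critical (T : finType) (e : rel T) (s : state T) : Prop :=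
  forall v, s (inl v) = deg e v.

Definition can_fire (T : finType) (e : rel T) (s : state T) (v : T) : bool :=
  (deg e v).+1 <= s (inl v).

Definition fire (T : finType) (e : rel T) (s : state T) (v : T) : state T :=
  [ffun x => s x - (if x == inl v then (deg e v).+1 else 0) + arc e (inl v) x].

Definition add_chip (T : finType) (r : T) (s : state T) : state T :=
  [ffun x => s x + (x == inl r)].

(* stabilizes e s t: some sequence of legal firings leads from s to t, and no
   vertex can fire in t. *)
Inductive stabilizes (T : finType) (e : rel T) : state T -> state T -> Prop :=
  | stab_done s : (forall v, ~~ can_fire e s v) -> stabilizes e s s
  | stab_fire s v t :
      can_fire e s v -> stabilizes e (fire e s v) t -> stabilizes e s t.

(* The stable states met during the process, after at least one chip has been
   added and up to and including the first return to critical loading. *)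
Inductive reached (T : finType) (e : rel T) (r : T) : state T -> Prop :=
  | reached_first s :
      stabilizes e (add_chip r (critical_loading e)) s -> reached e r s
  | reached_next s t :
      reached e r s -> ~ critical e s ->
      stabilizes e (add_chip r s) t -> reached e r t.

Definition returned (T : finType) (e : rel T) (r : T) (s : state T) : Prop :=
  reached e r s /\ critical e s.

(* The process terminates, and its final state does not depend on the order of
   the firings (returned_exists, returned_unique). *)

Definition add (T : finType) (d s : state T) : state T :=
  [ffun x => s x + d x].

Lemma fire_add (T : finType) (e : rel T) d s v :
  can_fire e s v -> fire e (add d s) v = add d (fire e s v).
Proof.
rewrite /can_fire => h; apply/ffunP => x; rewrite !ffunE.
case: eqP => [->|_]; first by rewrite -addnBAC // addnAC.
by rewrite !subn0 addnAC.
Qed.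

Lemma can_fire_add (T : finType) (e : rel T) d s v :
  can_fire e s v -> can_fire e (add d s) v.
Proof. by rewrite /can_fire ffunE => /leq_trans; apply; apply: leq_addr. Qed.

Lemma can_fire_fire (T : finType) (e : rel T) s u v :
  u != v -> can_fire e s u -> can_fire e (fire e s v) u.
Proof.
rewrite /can_fire ffunE => uv /leq_trans; apply.
by rewrite (inj_eq (@inl_inj _ _)) (negbTE uv) subn0 leq_addr.
Qed.

Lemma fireC (T : finType) (e : rel T) s u v :
  u != v -> can_fire e s u -> can_fire e s v ->
  fire e (fire e s u) v = fire e (fire e s v) u.
Proof.
rewrite /can_fire => uv hu hv; apply/ffunP => x; rewrite !ffunE.
case: (x =P inl u) => [->|_].
  by rewrite (inj_eq (@inl_inj _ _)) (negbTE uv) !subn0 -addnBAC // addnAC.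
by case: eqP => [->|_]; rewrite !subn0 -?addnBAC // addnAC.
Qed.

(* Every firing moves a chip to an absorbing vertex. *)
Lemma stabilizes_exists (T : finType) (e : rel T) s :
  exists t, stabilizes e s t.
Proof.
have [n] := ubnP (\sum_v s (inl v)); elim: n s => // n IHn s le_sn.
have [/existsP[v fv]|/existsPn st] := boolP [exists v, can_fire e s v]; last first.
  by exists s; apply: stab_done.
have [|t st] := IHn (fire e s v); last by exists t; apply: stab_fire fv st.
rewrite ltnS in le_sn; apply: leq_trans le_sn.
suff -> : \sum_u s (inl u) = (\sum_u fire e s v (inl u)).+1 by [].
have Ed : \sum_u arc e (inl v) (inl u) = deg e v.
  rewrite /deg -sum1_card [RHS]big_mkcond.
  by apply: eq_bigr => u _; rewrite inE /=; case: (e v u).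
have -> : \sum_u fire e s v (inl u) =
    \sum_u (s (inl u) - (if u == v then (deg e v).+1 else 0)) + deg e v.
  rewrite -[X in _ = _ + X]Ed -big_split; apply: eq_bigr => u _.
  by rewrite ffunE (inj_eq (@inl_inj _ _)).
rewrite (bigD1 v) //= [in RHS](bigD1 v) //= eqxx.
rewrite [in RHS](eq_bigr (fun u => s (inl u))); last first.
  by move=> u /negbTE->; rewrite subn0.
by rewrite -addnS addnAC subnK.
Qed.

Lemma stabilizes_fire (T : finType) (e : rel T) s t u :
  stabilizes e s t -> can_fire e s u -> stabilizes e (fire e s u) t.
Proof.
move=> st; elim: st u => {s t} [s nf|s v t fv st IH] u fu.
  by rewrite (negbTE (nf u)) in fu.
have [-> //|uv] := eqVneq u v.
apply: (stab_fire (v := v)); first by rewrite can_fire_fire // eq_sym.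
by rewrite fireC //; apply: IH; rewrite can_fire_fire.
Qed.

Lemma stabilizes_unique (T : finType) (e : rel T) s t t' :
  stabilizes e s t -> stabilizes e s t' -> t = t'.
Proof.
elim=> {s t} [s nf|s v t fv st IH] st'; last by apply: IH; apply: stabilizes_fire.
case: st' nf => // {}s v t'' fv _ /(_ v); by rewrite fv.
Qed.

Lemma stabilizes_stable (T : finType) (e : rel T) s t v :
  stabilizes e s t -> t (inl v) <= deg e v.
Proof. by elim=> // {}s /(_ v); rewrite -leqNgt. Qed.

Lemma stabilizes_add (T : finType) (e : rel T) d s t t' :
  stabilizes e s t -> stabilizes e (add d t) t' -> stabilizes e (add d s) t'.
Proof.
elim=> // {}s v {}t fv _ IH /IH st.
by apply: (stab_fire (can_fire_add d fv)); rewrite fire_add.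
Qed.

Definition eq_chips (T : finType) (s t : state T) : Prop :=
  forall v, s (inl v) = t (inl v).

Lemma stabilizes_eq (T : finType) (e : rel T) s t s' t' :
  eq_chips s s' -> stabilizes e s t -> stabilizes e s' t' -> eq_chips t t'.
Proof.
move=> ss' st; elim: st s' t' ss' => {s t} [s nf|s v t fv st IH] s' t' ss' st'.
  by case: st' ss' => // {}s' v t'' fv _ /(_ v); move: (nf v) fv;
     rewrite /can_fire => + + E; rewrite E => /negbTE->.
have fv' : can_fire e s' v by move: fv; rewrite /can_fire ss'.
by apply: (IH (fire e s' v)); [move=> u; rewrite !ffunE ss' | apply: stabilizes_fire].
Qed.

Definition stab (T : finType) (e : rel T) (s : state T) : state T :=
  sval (cid (stabilizes_exists e s)).

Lemma stabP (T : finType) (e : rel T) s : stabilizes e s (stab e s).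
Proof. exact: svalP (cid (stabilizes_exists e s)). Qed.

Lemma stabE (T : finType) (e : rel T) s t : stabilizes e s t -> stab e s = t.
Proof. by apply: stabilizes_unique; apply: stabP. Qed.

Lemma stab_add (T : finType) (e : rel T) d s :
  stab e (add d (stab e s)) = stab e (add d s).
Proof. by apply/esym/stabE; apply: stabilizes_add (stabP e s) (stabP _ _). Qed.

Definition drop_chip (T : finType) (e : rel T) (r : T) (s : state T) : state T :=
  stab e (add_chip r s).

Lemma drop_chip_add (T : finType) (e : rel T) r d s :
  drop_chip e r (stab e (add d s)) = stab e (add d (drop_chip e r s)).
Proof.
have E t : add_chip r t = add [ffun x => (x == inl r) : nat] t.
  by apply/ffunP => x; rewrite !ffunE.
rewrite /drop_chip !E !stab_add; congr stab.
by apply/ffunP => x; rewrite !ffunE addnAC.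
Qed.

Lemma iter_drop_chip_eq (T : finType) (e : rel T) r n s s' :
  eq_chips s s' ->
  eq_chips (iter n (drop_chip e r) s) (iter n (drop_chip e r) s').
Proof.
move=> ss'; elim: n => //= n IH.
apply: stabilizes_eq (stabP _ _) (stabP _ _) => v.
by rewrite !ffunE IH.
Qed.

Lemma iter_drop_chip_le (T : finType) (e : rel T) r n v :
  iter n (drop_chip e r) (critical_loading e) (inl v) <= deg e v.
Proof.
case: n => [|n] /=; first by rewrite ffunE.
exact: stabilizes_stable (stabP _ _).
Qed.

Lemma iter_drop_chip_critical (T : finType) (e : rel T) (r : T) :
  exists2 n, 0 < n & critical e (iter n (drop_chip e r) (critical_loading e)).
Proof.
set F := drop_chip e r; set c := critical_loading e.
pose C := {ffun T -> 'I_#|T|.+1}.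
pose g (i : 'I_#|{: C}|.+1) : C := [ffun v => inord (iter i F c (inl v))].
have /injectivePn[i [j ij /ffunP gij]] : ~~ injectiveb g.
  by apply/injectiveP => /leq_card; rewrite card_ord ltnn.
wlog {ij} ij : i j gij / i < j.
  move=> H; have [/H|/H|/val_inj/eqP] := ltngtP i j; [exact| |by rewrite (negbTE ij)].
  by apply=> v; rewrite gij.
have leT v n : iter n F c (inl v) < #|T|.+1.
  rewrite ltnS (leq_trans (iter_drop_chip_le _ _ _ _)) //; exact: max_card.
have Eij : eq_chips (iter i F c) (iter j F c).
  by move=> v; have := gij v; rewrite !ffunE => /(congr1 val); rewrite /= !inordK.
pose d : state T := [ffun x => c x - iter i F c x].
have Ed : eq_chips c (add d (iter i F c)).
  by move=> v; rewrite !ffunE subnKC // iter_drop_chip_le.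
have Es : stab e (add d (iter i F c)) = add d (iter i F c).
  apply/stabE/stab_done => v; rewrite /can_fire -Ed ffunE; by rewrite ltnn.
have Ek k s : iter k F (stab e (add d s)) = stab e (add d (iter k F s)).
  by elim: k => //= k ->; rewrite /F drop_chip_add.
exists (j - i); first by rewrite subn_gt0.
move=> v; rewrite (iter_drop_chip_eq _ _ _ Ed) -Es Ek -iterD subnK 1?ltnW //.
have -> : stab e (add d (iter j F c)) (inl v) = stab e (add d (iter i F c)) (inl v).
  by apply: stabilizes_eq (stabP _ _) (stabP _ _) _ => u; rewrite !ffunE Eij.
by rewrite Es -Ed ffunE.
Qed.

Lemma reached_iter (T : finType) (e : rel T) (r : T) s :
  reached e r s <-> exists n,
    s = iter n.+1 (drop_chip e r) (critical_loading e) /\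
    forall k, 0 < k <= n -> ~ critical e (iter k (drop_chip e r) (critical_loading e)).
Proof.
split.
  elim=> {s} [s /stabE<-|s t _ [n [-> nc]] ncs /stabE<-].
    by exists 0; split=> // k; rewrite leqn0 lt0n; case: eqP.
  exists n.+1; split=> // k /andP[k0]; rewrite leq_eqVlt => /orP[/eqP-> //|kn].
  by apply: nc; rewrite k0.
case=> n [-> {s}]; elim: n => [|n IH] nc.
  exact/reached_first/stabP.
apply: (@reached_next _ _ _ (iter n.+1 (drop_chip e r) (critical_loading e))).
- by apply: IH => k /andP[k0 kn]; apply: nc; rewrite k0 ltnW.
- by apply: nc; rewrite ltnSn.
- exact: stabP.
Qed.

Lemma returned_exists (T : finType) (e : rel T) (r : T) :
  exists s, returned e r s.
Proof.
have [n n0 cn] := iter_drop_chip_critical e r.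
pose P k := (0 < k) && `[< critical e (iter k (drop_chip e r) (critical_loading e)) >].
have exP : exists k, P k by exists n; rewrite /P n0; apply/asboolP.
case: (ex_minnP exP) => [[|k]] /andP[//= _ /asboolP ck] mink.
exists (iter k.+1 (drop_chip e r) (critical_loading e)); split=> //.
apply/reached_iter; exists k; split=> // i /andP[i0 ik] ci.
have := mink i; rewrite /P i0 ltnNge ik; move/asboolP: ci => -> /=.
by move/(_ isT).
Qed.

Lemma returned_unique (T : finType) (e : rel T) (r : T) s s' :
  returned e r s -> returned e r s' -> s = s'.
Proof.
case=> /reached_iter[n [-> ncn]] cn [/reached_iter[m [-> ncm]]] cm.
have [nm|mn|-> //] := ltngtP n m.
  by case: (ncm n.+1).
by case: (ncn m.+1).
Qed.

Definition restoration (T : finType) (e : rel T) (r v : T) : nat :=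
  sval (cid (returned_exists e r)) (inr v).

Definition period (T : finType) (e : rel T) (r : T) : nat :=
  restoration (plant e r) None None.

(* Main.v *)
Require Import Defs.
From mathcomp Require Import all_boot all_order all_algebra.
From mathcomp Require Import boolp zify.
Import GRing.Theory Num.Theory.

(** Why the formula holds.  Let [d u] count the firings of [u].  Comparing the
    chips that enter and leave each vertex, the stable state obtained after
    [n] drops at the root is critical only if

      (deg x + 1) d x = n [x = root] + sum of d over the neighbours of x

    at every vertex [x] ([balanced], [critical_balanced]).  The converse holds
    too: from the critical loading plus [n] chips at the root, any balanced [d]
    can be carried out by legal firings, because a vertex whose outstanding
    count is largest can always fire ([stabilizes_excess],
    [balanced_critical]).  So the abacus returns to critical loading exactly at
    the least positive [n] that admits a balanced [d], and this [d], unique for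
    its [n], is the restoration function ([restoration_least],
    [restorationE]).

    Let [n] and [R] be this least solution for [T] with root [v].  In the
    planted tree with new root [w], the equations at the vertices of [T] say
    that the restriction of a solution [d] to [T] is balanced for the
    [d w - d v] chips that pass, in net terms, from [w] to [v]
    ([balanced_unplant]).  All solutions on [T] being proportional, the least
    one upstairs restricts to [R] and has [d w = n + R v]
    ([least_balanced_plant]); hence the period is [n + R v].  The equation of
    [R] at [v] is [n = (m + 1) R v - sum of R over the children], which gives
    the formula ([period_root_balance]). *)

Set Implicit Arguments.
Unset Strict Implicit.
Unset Printing Implicit Defensive.

(** * Balanced firing counts *)

Definition inflow (T : finType) (e : rel T) (d : T -> nat) (x : T) : nat :=
  \sum_(u | e u x) d u.

(** This is the linear system (L + I) d = n * delta_r, with L the graph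
    Laplacian, written without subtraction. *)
Definition balanced (T : finType) (e : rel T) (r : T) (n : nat) (d : T -> nat) :=
  forall x, (deg e x).+1 * d x = n * (x == r) + inflow e d x.

Lemma inflowD (T : finType) (e : rel T) d d' x :
  inflow e (fun u => d u + d' u) x = inflow e d x + inflow e d' x.
Proof. exact: big_split. Qed.

Lemma inflow_delta (T : finType) (e : rel T) v x :
  inflow e (fun u => (u == v) : nat) x = e v x.
Proof.
rewrite /inflow big_mkcond (bigD1 v) //= eqxx big1 ?addn0; first by case: (e v x).
by move=> u /negbTE->; case: (e u x).
Qed.

Lemma inflowZ (T : finType) (e : rel T) k d x :
  inflow e (fun u => k * d u) x = k * inflow e d x.
Proof. by rewrite /inflow big_distrr. Qed.

Lemma sum_inflow (T : finType) (e : rel T) d :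
  \sum_x inflow e d x = \sum_x deg e x * d x.
Proof.
rewrite /inflow (exchange_big_dep xpredT) //=; apply: eq_bigr => u _.
by rewrite sum_nat_const; congr (_ * _); apply: eq_card => x; rewrite !inE.
Qed.

Lemma inflow_le (T : finType) (e : rel T) d x M :
  symmetric e -> (forall u, d u <= M) -> inflow e d x <= deg e x * M.
Proof.
move=> sym dM; rewrite /inflow /deg -sum_nat_const.
rewrite (eq_bigl [in [set u | e x u]]) => [|u]; last by rewrite inE sym.
exact: leq_sum.
Qed.

(** Each firing removes exactly one chip from the non-absorbing vertices, so a
    run that restores the loading has as many firings as chips added. *)
Lemma balanced_sum (T : finType) (e : rel T) r n d :
  balanced e r n d -> \sum_x d x = n.
Proof.
move=> bal; apply/eqP; rewrite -(eqn_add2l (\sum_x deg e x * d x)).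
rewrite -big_split /= (eq_bigr (fun x => n * (x == r) + inflow e d x)); last first.
  by move=> x _; rewrite -bal mulSn addnC.
rewrite big_split /= sum_inflow addnC eqn_add2l (bigD1 r) //= eqxx big1 => [|x /negbTE->].
  by rewrite muln1 addn0.
by rewrite muln0.
Qed.

Lemma balancedZ (T : finType) (e : rel T) r n d k :
  balanced e r n d -> balanced e r (k * n) (fun x => k * d x).
Proof. by move=> bal x; rewrite mulnCA bal mulnDr inflowZ mulnA. Qed.

(** * Legal firings and balance *)

(** The hypothesis says that [s] exceeds the critical loading by exactly what is
    lost when every [x] fires [d x] times.  A legal order for these firings
    exists: at a vertex [v] where [d] is maximal, the inflow is at most
    [deg v * d v], so the excess is at least [d v > 0] and [v] can fire; then
    [d v] drops by one and the hypothesis persists. *)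
Lemma stabilizes_excess (T : finType) (e : rel T) (s : state T) (d : T -> nat) :
  symmetric e ->
  (forall x, s (inl x) + inflow e d x = deg e x + (deg e x).+1 * d x) ->
  exists2 t, stabilizes e s t &
    critical e t /\ forall x, t (inr x) = s (inr x) + d x.
Proof.
move=> sym; have [n] := ubnP (\sum_x d x).
elim: n s d => // n IHn s d lt_dn sd.
have [/existsP[u du]|/existsPn d0] := boolP [exists x, 0 < d x]; last first.
  have {}d0 x : d x = 0 by apply/eqP; rewrite -leqn0 leqNgt d0.
  have sc x : s (inl x) = deg e x.
    by move: (sd x); rewrite d0 muln0 /inflow big1 ?addn0.
  exists s; first by apply: stab_done => x; rewrite /can_fire sc ltnn.
  by split=> // x; rewrite d0 addn0.
have [v _ dv] := @arg_maxnP _ u xpredT d isT.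
have dv0 : 0 < d v by apply: leq_trans du (dv u isT).
have fv : can_fire e s v.
  have := inflow_le v sym (fun u => dv u isT).
  by rewrite /can_fire; move: (sd v); nia.
pose d' x := d x - (x == v).
have dE x : d x = d' x + (x == v) by rewrite /d'; case: eqP => [->|_]; lia.
have inflowE x : inflow e d x = inflow e d' x + e v x.
  by rewrite -inflow_delta -inflowD; apply: eq_bigr => y _.
have [||t st [ct tE]] := IHn (fire e s v) d'.
- rewrite ltnS in lt_dn; apply: leq_trans lt_dn.
  rewrite [ltnRHS](eq_bigr _ (fun x _ => dE x)) big_split /=.
  rewrite (bigD1 v (F := fun x => (x == v) : nat)) //= eqxx; lia.
- move=> x; rewrite ffunE (inj_eq (@inl_inj _ _)) /=.
  move: (sd x) fv; rewrite dE inflowE /can_fire; case: eqP => [->|_]; nia.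
exists t; first exact: stab_fire fv st.
split=> // x; rewrite tE ffunE /= subn0 dE eq_sym; lia.
Qed.

(** The absorbing vertex [inr x] gains one chip per firing of [x], so it records
    the firings and the balance of chips at [x] needs no separate counter.  The
    chips received from neighbours during the run are the change of the inflow;
    the two inflows sit on opposite sides to avoid truncated subtraction. *)
Lemma stabilizes_conserve (T : finType) (e : rel T) (s t : state T) x :
  stabilizes e s t ->
  s (inl x) + (deg e x).+1 * s (inr x) + inflow e (t \o inr) x =
  t (inl x) + (deg e x).+1 * t (inr x) + inflow e (s \o inr) x.
Proof.
elim=> // {}s v {}t fv _.
have -> : inflow e (fire e s v \o inr) x = inflow e (s \o inr) x + e v x.
  rewrite -inflow_delta -inflowD; apply: eq_bigr => y _.
  by rewrite /= ffunE /= subn0 eq_sym.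
rewrite !ffunE (inj_eq (@inl_inj _ _)) /= subn0 (eq_sym v x).
move: fv; rewrite /can_fire; case: eqP => [->|_] /=; nia.
Qed.

(** By confluence, chips may all be added before any firing. *)
Lemma iter_drop_chipE (T : finType) (e : rel T) r n :
  iter n (drop_chip e r) (critical_loading e) =
  stab e (Defs.add [ffun x => n * (x == inl r)] (critical_loading e)).
Proof.
elim: n => [|n IH] /=.
  apply/esym/stabE.
  rewrite (_ : Defs.add _ _ = critical_loading e); last first.
    by apply/ffunP => x; rewrite !ffunE mul0n addn0.
  by apply: stab_done => x; rewrite /can_fire ffunE ltnn.
have E t : add_chip r t = Defs.add [ffun x => (x == inl r) : nat] t.
  by apply/ffunP => x; rewrite !ffunE.
rewrite /drop_chip IH E stab_add; congr stab.
by apply/ffunP => x; rewrite !ffunE mulSn addnA addnAC.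
Qed.

Lemma critical_balanced (T : finType) (e : rel T) r n :
  let s := iter n (drop_chip e r) (critical_loading e) in
  critical e s -> balanced e r n (s \o inr).
Proof.
rewrite /= iter_drop_chipE; set s := stab e _ => cs x.
have := stabilizes_conserve x (stabP e _ : stabilizes e _ s).
rewrite (_ : inflow e (Defs.add _ _ \o inr) x = 0); last first.
  by apply: big1 => u _; rewrite /= !ffunE muln0.
by rewrite !ffunE (inj_eq (@inl_inj _ _)) cs !muln0 /=; lia.
Qed.

Lemma balanced_critical (T : finType) (e : rel T) r n d :
  symmetric e -> balanced e r n d ->
  let s := iter n (drop_chip e r) (critical_loading e) in
  critical e s /\ forall x, s (inr x) = d x.
Proof.
move=> sym bal; rewrite /= iter_drop_chipE.
have [|t /stabE -> [ct tE]] := @stabilizes_excess _ e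
    (Defs.add [ffun x => n * (x == inl r)] (critical_loading e)) d sym.
  by move=> x; rewrite !ffunE (inj_eq (@inl_inj _ _)) bal addnA.
by split=> // x; rewrite tE !ffunE muln0.
Qed.

(** Stabilization is deterministic, and both [d] and [d'] are its firing
    counts. *)
Lemma balanced_unique (T : finType) (e : rel T) r n d d' :
  symmetric e -> balanced e r n d -> balanced e r n d' -> d =1 d'.
Proof.
move=> sym b b' x; have [_ <-] := balanced_critical sym b.
by have [_ ->] := balanced_critical sym b'.
Qed.

(** Scaled to [n * n'] chips, the two solutions coincide. *)
Lemma balanced_proportional (T : finType) (e : rel T) r n d n' d' x :
  symmetric e -> balanced e r n d -> balanced e r n' d' -> n' * d x = n * d' x.
Proof.
move=> sym b b'; have bn := balancedZ n' b; rewrite mulnC in bn.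
exact: balanced_unique sym bn (balancedZ n b') x.
Qed.

(** * The restoration function as the least balanced count *)

Definition least_balanced (T : finType) (e : rel T) r n d :=
  [/\ 0 < n, balanced e r n d &
      forall n' d', 0 < n' -> balanced e r n' d' -> n <= n'].

Lemma restoration_least (T : finType) (e : rel T) r :
  symmetric e -> exists n, least_balanced e r n (restoration e r).
Proof.
move=> sym; rewrite /restoration; case: cid => s /= [].
move=> /reached_iter[n [-> nc]] cs; exists n.+1; split=> //.
  exact: critical_balanced cs.
move=> k d k0 bal; rewrite leqNgt; apply/negP => kn.
by apply: (nc k); [rewrite k0 | have [] := balanced_critical sym bal].
Qed.

(** The characterization by which a restoration function is computed: exhibit a
    solution and check that its number of chips is least. *)
Lemma restorationE (T : finType) (e : rel T) r n d :
  symmetric e -> least_balanced e r n d -> restoration e r =1 d.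
Proof.
move=> sym [n0 bal min]; have [k [k0 kbal kmin]] := restoration_least r sym.
have nk : n = k by apply/eqP; rewrite eqn_leq (min _ _ k0 kbal) (kmin _ _ n0 bal).
by rewrite -nk in kbal; apply: balanced_unique sym kbal bal.
Qed.

(** * Planting a tree on a new root *)

Lemma sum_option (T : finType) (P : pred (option T)) (F : option T -> nat) :
  \sum_(x | P x) F x = P None * F None + \sum_(x | P (Some x)) F (Some x).
Proof.
rewrite big_mkcond (bigD1 None) //= [in RHS]big_mkcond; congr (_ + _).
  by case: (P None); rewrite ?mul1n.
rewrite (reindex_omap Some id) => [|[x|]] //.
by apply: eq_bigl => x; rewrite /= eqxx.
Qed.

Lemma deg_plant_Some (T : finType) (e : rel T) v x :
  deg (plant e v) (Some x) = deg e x + (x == v).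
Proof.
rewrite /deg -!sum1_card !(eq_bigl _ _ (fun x => in_set _ x)) sum_option /= muln1.
by rewrite addnC.
Qed.

Lemma deg_plant_None (T : finType) (e : rel T) v : deg (plant e v) None = 1.
Proof.
by rewrite /deg -sum1_card (eq_bigl _ _ (fun x => in_set _ x)) sum_option /= big_pred1_eq.
Qed.

(** The system splits into the equation at the new root and those of the old
    graph, where [v] has one more neighbour and one more unit of degree. *)
Lemma balanced_plantE (T : finType) (e : rel T) v n (d : option T -> nat) :
  balanced (plant e v) None n d <->
  [/\ 2 * d None = n + d (Some v) &
      forall x, (deg e x).+1 * d (Some x) + (x == v) * d (Some v) =
                (x == v) * d None + inflow e (d \o Some) x].
Proof.
split=> [bal|[balN balS] [x|]].
- split=> [|x].
    have := bal None; rewrite deg_plant_None /inflow sum_option /= big_pred1_eq.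
    by rewrite muln1.
  have := bal (Some x); rewrite deg_plant_Some /inflow sum_option /=.
  case: (x =P v) => [->|_] /=; nia.
- rewrite deg_plant_Some /inflow sum_option /=; have := balS x; rewrite /inflow /=.
  case: (x =P v) => [->|_] /=; nia.
by rewrite deg_plant_None /inflow sum_option /= big_pred1_eq muln1.
Qed.

(** The net number [k] of chips sent from the new root to [v] is nonnegative
    because, as [balanced_sum] shows by adding all equations, it is the number of
    firings in the old graph. *)
Lemma balanced_unplant (T : finType) (e : rel T) v n (d : option T -> nat) :
  balanced (plant e v) None n d ->
  exists2 k, d None = k + d (Some v) & balanced e v k (d \o Some).
Proof.
move=> bal; have [balN balS] := (balanced_plantE e v n d).1 bal.
have /= := balanced_sum bal; rewrite (sum_option xpredT) mul1n (bigD1 v) //= => sumd.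
have le_vN : d (Some v) <= d None by lia.
exists (d None - d (Some v)); first by rewrite subnK.
by move=> x; have := balS x; case: (x =P v) => [->|_] /=; nia.
Qed.

(** A solution with [n'] chips has [n' = 2 * d' None - d' (Some v)], which is
    [2 * k + d' (Some v)] when [k] net chips pass to the old graph.  There
    [k >= n] by minimality, unless [k = 0] and no vertex ever fires, and
    proportionality then gives [d' (Some v) >= d v]. *)
Lemma least_balanced_plant (T : finType) (e : rel T) v n d :
  symmetric e -> least_balanced e v n d ->
  least_balanced (plant e v) None (2 * n + d v) (oapp d (n + d v)).
Proof.
move=> sym [n0 bal min]; split; first lia.
  apply/balanced_plantE; split=> [|x] /=; first lia.
  by have := bal x; rewrite /inflow /=; case: (x =P v) => [->|_]; nia.
move=> n' d' n'0 bal'; have [balN _] := (balanced_plantE e v n' d').1 bal'.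
have [k dN balk] := balanced_unplant bal'.
have k0 : 0 < k.
  rewrite lt0n; apply/eqP => k0; move: balk; rewrite k0 => /balanced_sum/eqP.
  by rewrite sum_nat_eq0 => /forallP/(_ v)/eqP /=; lia.
have nk := min _ _ k0 balk.
have := balanced_proportional v sym bal balk; rewrite /=.
nia.
Qed.

(** * The period *)

Lemma period_root_balance (T : finType) (e : rel T) v :
  symmetric e ->
  period e v + inflow e (restoration e v) v = (deg e v).+2 * restoration e v v.
Proof.
move=> sym; have [n least] := restoration_least v sym; have [_ bal _] := least.
have psym : symmetric (plant e v) by case=> [x|] [y|] /=.
rewrite /period (restorationE psym (least_balanced_plant sym least)) /=.
by have := bal v; rewrite eqxx; lia.
Qed.

Local Open Scope ring_scope.

Theorem theorem3p4 (T : finType) (e : rel T) (v : T) (m : nat) (c : 'I_m -> T)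
    (T_tree : is_tree e) (c_inj : injective c)
    (c_children : forall u : T, e v u <-> exists i, c i = u) :
  (period e v)%:Z =
    (m%:Z + 2) * (restoration e v v)%:Z - \sum_(i < m) (restoration e v (c i))%:Z.
Proof.
have [sym _ _ _] := T_tree.
have nbrs u : (u \in codom c) = e v u.
  apply/idP/idP => [/codomP[i ->]|/c_children[i <-]]; last exact: codom_f.
  by apply/c_children; exists i.
have degE : deg e v = m.
  rewrite /deg -[RHS](card_ord m) -(card_codom c_inj).
  by apply: eq_card => u; rewrite inE nbrs.
have inflowE : inflow e (restoration e v) v = (\sum_(i < m) restoration e v (c i))%N.
  rewrite /inflow (eq_bigl [in codom c]) => [|u]; last by rewrite nbrs sym.
  by rewrite -big_uniq ?big_image //=; apply/injectiveP.
have := period_root_balance v sym; rewrite degE inflowE.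
rewrite -(big_morph Posz PoszD (erefl _)).
move: (\sum_i _)%N => S; lia.
Qed.
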